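(* Let $K/k$ be a separable field extension of degree $4$ with Galois closure $\widetilde{K}/k$. Suppose $\operatorname{Gal}(\widetilde{K}/k)\simeq S_4$ and let $F$ be a field with $K\subseteq F\subseteq\widetilde{K}$. Then $F/k$ is Hopf Galois. If $[F:k]=12$, then $F/k$ is almost classically Galois; if $[F:k]=8$, then $F/k$ is not almost classically Galois.
   Context: A finite extension of fields $L/k$ is called Hopf Galois if there exists a finite cocommutative $k$-Hopf algebra $H$ such that $L$ is an $H$-module algebra and the $k$-linear map $j: L\otimes_k H\to \operatorname{End}_k(L)$, $j(s\otimes h)(t)=s(ht)$ for $h\in H$, $s,t\in L$, is bijective. Let $L/k$ be a finite separable extension with Galois closure $\widetilde{L}/k$, $\Gamma=\operatorname{Gal}(\widetilde{L}/k)$, $\Gamma'=\operatorname{Gal}(\widetilde{L}/L)$, and let $\lambda:\Gamma\to\operatorname{Sym}(\Gamma/\Gamma')$ be the left translation action on left cosets. $L/k$ is called almost classically Galois if there is a regular (i.e. sharply transitive) subgroup $N$ of $\operatorname{Sym}(\Gamma/\Gamma')$ which is normalized by $\lambda(\Gamma)$ and contained in $\lambda(\Gamma)$; equivalently, $\Gamma'$ has a normal complement in $\Gamma$. *)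

(* Defs.v *)
From HB Require Import structures.
From mathcomp Require Import all_boot all_order all_fingroup all_algebra.
From mathcomp Require Import all_solvable all_field.

Set Implicit Arguments.
Unset Strict Implicit.
Unset Printing Implicit Defensive.

Import GroupScope GRing.Theory VectorInternalTheory.
Local Open Scope ring_scope.

(* Tensor products of finite-dimensional vector spaces. [U (x) V] is modelled *)
(* by coordinate matrices; [tens_lift_unique] is its universal property.      *)

Definition tensor (k : fieldType) (U V : vectType k) : Type :=
  'M[k]_(dim U, dim V).

HB.instance Definition _ (k : fieldType) (U V : vectType k) :=
  Vector.on (tensor U V).

Definition tens (k : fieldType) (U V : vectType k) (u : U) (v : V) :
    tensor U V :=
  (v2r u)^T *m v2r v.

Reserved Notation "u \ox v" (at level 40, left associativity).
Notation "u \ox v" := (tens u v) : ring_scope.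

Definition coord_basis (k : fieldType) (U : vectType k) (i : 'I_(dim U)) : U :=
  r2v (delta_mx 0 i).

Definition tens_lift_fun (k : fieldType) (U V W : vectType k)
    (f : U -> V -> W) (x : tensor U V) : W :=
  \sum_i \sum_j (x : 'M[k]_(dim U, dim V)) i j
    *: f (coord_basis i) (coord_basis j).

(* The linear map induced by [f]; it is meaningful only for bilinear [f]. *)
Definition tens_lift (k : fieldType) (U V W : vectType k) (f : U -> V -> W) :
    'Hom(tensor U V, W) :=
  linfun (tens_lift_fun f).

Lemma tens_lift_fun_linear (k : fieldType) (U V W : vectType k)
  (f : U -> V -> W) : linear (tens_lift_fun f).
Proof.
move=> a x y; rewrite /tens_lift_fun scaler_sumr -big_split /=.
apply: eq_bigr => i _; rewrite scaler_sumr -big_split /=.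
by apply: eq_bigr => j _; rewrite !mxE scalerDl scalerA.
Qed.

HB.instance Definition _ (k : fieldType) (U V W : vectType k)
    (f : U -> V -> W) :=
  GRing.isSemilinear.Build k (tensor U V) W *:%R (tens_lift_fun f)
    (GRing.semilinear_linear (tens_lift_fun_linear f)).

Lemma coord_basis_sum (k : fieldType) (U : vectType k) (u : U) :
  u = \sum_i v2r u 0 i *: coord_basis i.
Proof.
rewrite -{1}[u]v2rK {1}[v2r u]row_sum_delta linear_sum /=.
by apply: eq_bigr => i _; rewrite linearZ.
Qed.

Lemma tens_liftE (k : fieldType) (U V W : vectType k) (f : U -> V -> W)
    (fl : forall v, linear (f^~ v)) (fr : forall u, linear (f u))
    (u : U) (v : V) :
  tens_lift f (u \ox v) = f u v.
Proof.
rewrite lfunE /= /tens_lift_fun.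
pose fL w := GRing.isLinear.Build k U W *:%R (f^~ w) (fl w).
pose FL w : {linear U -> W} := HB.pack (f^~ w) (fL w).
pose fR w := GRing.isLinear.Build k V W *:%R (f w) (fr w).
pose FR w : {linear V -> W} := HB.pack (f w) (fR w).
rewrite {2}[u]coord_basis_sum -[f _ v]/(FL v _) linear_sum /=.
apply: eq_bigr => i _; rewrite -[f _ v]/(FL v _) linearZ /=.
rewrite {2}[v]coord_basis_sum -[f (coord_basis i) _]/(FR (coord_basis i) _).
rewrite linear_sum scaler_sumr; apply: eq_bigr => j _.
by rewrite linearZ scalerA /tens mxE big_ord1 mxE.
Qed.

Lemma tens_basis (k : fieldType) (U V : vectType k) i j :
  coord_basis i \ox coord_basis j
    = (delta_mx i j : 'M[k]_(dim U, dim V)) :> tensor U V.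
Proof. by rewrite /tens /coord_basis !r2vK trmx_delta mul_delta_mx. Qed.

Lemma tens_lift_unique (k : fieldType) (U V W : vectType k)
    (f : U -> V -> W)
    (fl : forall v, linear (f^~ v)) (fr : forall u, linear (f u)) :
  exists! g : 'Hom(tensor U V, W), forall u v, g (u \ox v) = f u v.
Proof.
exists (tens_lift f); split=> [u v|g gE]; first exact: tens_liftE.
apply/lfunP => x; rewrite lfunE /= /tens_lift_fun.
rewrite {2}[x](matrix_sum_delta (x : 'M[k]_(dim U, dim V))).
rewrite linear_sum; apply: eq_bigr => i _ /=.
rewrite linear_sum; apply: eq_bigr => j _ /=.
by rewrite -tens_basis linearZ /= gE.
Qed.

Definition tens_map (k : fieldType) (U V U' V' : vectType k)
    (f : 'Hom(U, U')) (g : 'Hom(V, V')) : 'Hom(tensor U V, tensor U' V') :=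
  tens_lift (fun u v => f u \ox g v).

Definition tens_assoc (k : fieldType) (U V W : vectType k) :
    'Hom(tensor (tensor U V) W, tensor U (tensor V W)) :=
  tens_lift (fun x w => tens_lift (fun u v => u \ox (v \ox w)) x).

Definition tens_swap (k : fieldType) (U V : vectType k) :
    'Hom(tensor U V, tensor V U) :=
  tens_lift (fun u v => v \ox u).

Section HopfAlgebra.

Variables (k : fieldType) (H : falgType k).

Definition alg_mul : 'Hom(tensor H H, H) := tens_lift (fun a b => a * b).

(* (a (x) b) (c (x) d) = ac (x) bd *)
Definition tens_mul (x y : tensor H H) : tensor H H :=
  tens_lift (fun a b => tens_lift (fun c d => (a * c) \ox (b * d)) y) x.

Variables (Delta : 'Hom(H, tensor H H)) (eps : 'Hom(H, k^o)) (S : 'End(H)).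

Definition coassociative : Prop :=
  forall h : H,
    tens_assoc H H H (tens_map Delta \1%VF (Delta h))
      = tens_map \1%VF Delta (Delta h).

Definition counital : Prop :=
  forall h : H,
    tens_lift (fun a b => (eps a : k) *: b) (Delta h) = h
    /\ tens_lift (fun a b => (eps b : k) *: a) (Delta h) = h.

Definition comul_algebra_morphism : Prop :=
  Delta 1 = 1 \ox 1
  /\ forall a b : H, Delta (a * b) = tens_mul (Delta a) (Delta b).

Definition counit_algebra_morphism : Prop :=
  eps 1 = 1 /\ forall a b : H, eps (a * b) = eps a * eps b.

Definition antipodal : Prop :=
  forall h : H,
    alg_mul (tens_map S \1%VF (Delta h)) = (eps h : k)%:A
    /\ alg_mul (tens_map \1%VF S (Delta h)) = (eps h : k)%:A.

Definition cocommutative : Prop :=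
  forall h : H, tens_swap H H (Delta h) = Delta h.

Definition is_hopf_algebra : Prop :=
  [/\ coassociative, counital, comul_algebra_morphism,
      counit_algebra_morphism & antipodal].

End HopfAlgebra.

(* Finite-dimensional; [falgType] excludes only the zero ring, which carries  *)
(* no Hopf algebra structure since the counit maps 1 to 1.                    *)
Record hopfAlgebra (k : fieldType) := HopfAlgebra {
  hopf_alg :> falgType k;
  comul : 'Hom(hopf_alg, tensor hopf_alg hopf_alg);
  counit : 'Hom(hopf_alg, k^o);
  antipode : 'End(hopf_alg);
  hopf_axioms : is_hopf_algebra comul counit antipode
}.

Section HopfGalois.

Variables (k : fieldType) (L : fieldExtType k) (H : hopfAlgebra k).
Variable act : 'Hom(H, 'End(L)).

Definition is_module : Prop :=
  act 1 = \1%VF /\ forall g h : H, act (g * h) = (act g \o act h)%VF.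

(* h (s t) = sum h_(1)(s) h_(2)(t) and h (1) = eps(h) 1 *)
Definition is_module_algebra : Prop :=
  [/\ is_module,
      forall (h : H) (s t : L),
        act h (s * t)
          = tens_lift (fun h1 h2 => act h1 s * act h2 t) (comul H h)
    & forall h : H, act h 1 = (counit H h : k)%:A].

(* j (s (x) h) (t) = s (h t) *)
Definition hopf_galois_map : 'Hom(tensor L H, 'End(L)) :=
  tens_lift (fun s h => (amull s \o act h)%VF).

End HopfGalois.

Definition hopf_galois (k : fieldType) (L : fieldExtType k) : Prop :=
  exists (H : hopfAlgebra k) (act : 'Hom(H, 'End(L))),
    [/\ cocommutative (comul H), is_module_algebra act
      & bijective (hopf_galois_map act)].

Section AlmostClassicallyGalois.

Local Open Scope group_scope.

(* [N] acts sharply transitively on [S]. *)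
Definition regular_on (rT : finType) (S : {set rT}) (N : {set {perm rT}}) :
    Prop :=
  N \subset perm.Sym S
  /\ {in S &, forall x y, exists! s, s \in N /\ s x = y}.

(* The product [x * y] of [gal_of E] is "x, then y" ([galM]), so the coset of *)
(* maps [sigma \o h], [h] in Gamma', is the set [Gamma' :* sigma] of          *)
(* [rcosets Gamma' Gamma], and left translation by [g], sending this coset to *)
(* that of [g \o sigma], is right multiplication by [g].                      *)
Definition translation (gT : finGroupType) (G H : {group gT}) :
    {morphism G >-> {perm {set gT}}} :=
  actperm_morphism (<[actsRs_rcosets H G]>)%act.

Variables (k : fieldType) (E : splittingFieldType k).

Definition galois_closure (L M : {subfield E}) : Prop :=
  [/\ (L <= M)%VS, galois 1%VS M
    & forall M' : {subfield E},
        (L <= M')%VS -> galois 1%VS M' -> (M <= M')%VS].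

Definition almost_classically_galois (L : {subfield E}) : Prop :=
  exists2 M : {subfield E}, galois_closure L M &
    let Gamma := 'Gal(M / 1%VS)%G in
    let Gamma' := 'Gal(M / L)%G in
    let lambda := translation Gamma Gamma' in
    exists N : {group {perm {set gal_of M}}},
      [/\ regular_on (rcosets Gamma' Gamma) N,
          lambda @* Gamma \subset 'N(N) & N \subset lambda @* Gamma].

End AlmostClassicallyGalois.

(* Main.v *)
(** For a finite Galois extension [E/k] with group [G] and a subfield [F], let
    [G] act by automorphisms on a finite group [N], and let [pi : G -> N] be a
    surjective 1-cocycle whose fibre over 1 is [Gal(E/F)].  Then [N] indexes the
    embeddings [F -> E], and the maps [f : N -> E] that commute with the two
    [G]-actions form a Hopf algebra [H = E[N]^G] acting on [F] by
    [l |-> sum_n f n * tau_n l], where [tau_n] is the embedding of index [n]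
    (this is one direction of the theorem of Greither and Pareigis).  By Galois
    descent the coefficients embed [H (x) H] in [E^(N * N)] as the space of
    equivariant maps, so that the comultiplication exists, and the Hopf algebra
    axioms can be read off on coefficients.

    In the theorem, [S = Gal(E/K)] has order 6 and contains no nontrivial normal
    subgroup of [G], [V] is the normal subgroup of order 4 and [A] the one of
    order 12.  A normal complement of [Gal(E/F)] yields a cocycle; one exists,
    namely [V], [A] or [G], except if [Gal(E/F)] has order 3, in which case
    [Gal(E/F) = S :&: A] and one takes [N = V * (G / A)].  A regular subgroup
    witnessing that [F] of degree 8 is almost classically Galois would be a
    normal subgroup of order 8 in S4; it would contain all transpositions. *)

From HB Require Import structures.
Require Import Defs.
From mathcomp Require Import all_boot all_order all_fingroup all_algebra.
From mathcomp Require Import all_solvable all_field.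

Set Implicit Arguments.
Unset Strict Implicit.
Unset Printing Implicit Defensive.

Import GroupScope GRing.Theory VectorInternalTheory.
Local Open Scope ring_scope.

(** * Tensor products and evaluations *)

Section Tensors.

Variable k : fieldType.

Lemma tens_linearl (U V X : vectType k) (f : X -> U) (v : V) :
  linear f -> linear (fun x => f x \ox v : tensor U V).
Proof.
by move=> fl a x y; rewrite /tens fl linearP /= linearP /= mulmxDl scalemxAl.
Qed.

Lemma tens_linearr (U V X : vectType k) (f : X -> V) (u : U) :
  linear f -> linear (fun x => u \ox f x : tensor U V).
Proof.
by move=> fl a x y; rewrite /tens fl linearP /= mulmxDr scalemxAr.
Qed.

Lemma linear_comb (U V : vectType k) (a : k) (f g : U -> V) :
  linear f -> linear g -> linear (fun x => a *: f x + g x).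
Proof.
move=> fl gl b x y; rewrite fl gl !scalerDr !scalerA addrACA.
by rewrite [b * a]mulrC.
Qed.

Lemma linear_mull (H : falgType k) (a : H) : linear (fun x => a * x).
Proof. by move=> e x y; rewrite mulrDr scalerAr. Qed.

Lemma linear_mulr (H : falgType k) (a : H) : linear (fun x => x * a).
Proof. by move=> e x y; rewrite mulrDl scalerAl. Qed.

(** Elementary tensors span. [f] and [g] are plain functions with proofs of linearity, so that whole
    expressions in a tensor can be compared without bundling them first. *)
Lemma tens_ext (U V W : vectType k) (f g : tensor U V -> W) :
    linear f -> linear g -> (forall u v, f (u \ox v) = g (u \ox v)) ->
  f =1 g.
Proof.
move=> fl gl fg x.
pose fL := GRing.isLinear.Build k _ W *:%R f fl.
pose FL : {linear tensor U V -> W} := HB.pack f fL.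
pose gL := GRing.isLinear.Build k _ W *:%R g gl.
pose GL : {linear tensor U V -> W} := HB.pack g gL.
have fE y : f y = linfun FL y by rewrite lfunE.
have gE y : g y = linfun GL y by rewrite lfunE.
rewrite fE gE [x](matrix_sum_delta (x : 'M[k]_(dim U, dim V))) !linear_sum.
apply: eq_bigr => i _ /=; rewrite !linear_sum; apply: eq_bigr => j _ /=.
by rewrite -tens_basis !linearZ /= -fE -gE fg.
Qed.

Lemma tens_mapE (U V U' V' : vectType k) (f : 'Hom(U, U')) (g : 'Hom(V, V'))
    u v : tens_map f g (u \ox v) = f u \ox g v.
Proof.
rewrite tens_liftE // => w.
  by apply: tens_linearl; apply: linearP.
by apply: tens_linearr; apply: linearP.
Qed.

Lemma tens_swapE (U V : vectType k) (u : U) (v : V) :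
  tens_swap U V (u \ox v) = v \ox u.
Proof.
rewrite tens_liftE // => w; first exact: (tens_linearr (f := id)).
exact: (tens_linearl (f := id)).
Qed.

(** [tens_assoc] and [tens_mul] nest one lift inside another; computing the outer lift requires the
    inner one to depend linearly on its parameter. *)
Lemma tens_lift_linear (U V W X : vectType k) (f : X -> U -> V -> W)
    (fl : forall x v, linear (f x ^~ v)) (fr : forall x u, linear (f x u))
    (fx : forall u v, linear (fun x => f x u v)) (t : tensor U V) :
  linear (fun x => tens_lift (f x) t).
Proof.
move=> a x y; apply: (tens_ext (f := fun t => tens_lift (f (a *: x + y)) t)
  (g := fun t => a *: tens_lift (f x) t + tens_lift (f y) t)) => [||u v].
- exact: linearP.
- by apply: linear_comb; apply: linearP.
- by rewrite !tens_liftE // fx.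
Qed.

Lemma tens_assocE (U V W : vectType k) (u : U) (v : V) (w : W) :
  tens_assoc U V W ((u \ox v) \ox w) = u \ox (v \ox w).
Proof.
have l1 z (y : V) :
    linear (fun x : U => x \ox (y \ox z) : tensor U (tensor V W)).
  exact: (tens_linearl (f := id)).
have l2 z (x : U) :
    linear (fun y : V => x \ox (y \ox z) : tensor U (tensor V W)).
  by apply: tens_linearr; apply: (tens_linearl (f := id)).
rewrite tens_liftE ?tens_liftE // => [z|x]; first exact: linearP.
apply: tens_lift_linear => // p q.
by apply: tens_linearr; apply: (tens_linearr (f := id)).
Qed.

Lemma tens_mul_linearl (H : falgType k) (y : tensor H H) :
  linear (fun x => tens_mul x y).
Proof. exact: linearP. Qed.

Lemma tens_mul_purel (H : falgType k) (a b : H) (y : tensor H H) :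
  tens_mul (a \ox b) y = tens_lift (fun c d => (a * c) \ox (b * d)) y.
Proof.
rewrite /tens_mul tens_liftE // => c; apply: tens_lift_linear => u v.
- by apply: tens_linearl; apply: linear_mull.
- by apply: tens_linearr; apply: linear_mull.
- by apply: tens_linearl; apply: linear_mulr.
- by apply: tens_linearl; apply: linear_mull.
- by apply: tens_linearr; apply: linear_mull.
- by apply: tens_linearr; apply: linear_mulr.
Qed.

Lemma tens_mul_linearr (H : falgType k) (x : tensor H H) :
  linear (tens_mul x).
Proof.
move=> e y z; apply: (tens_ext (f := fun x => tens_mul x (e *: y + z))
  (g := fun x => e *: tens_mul x y + tens_mul x z)) => [||a b].
- exact: tens_mul_linearl.
- by apply: linear_comb; apply: tens_mul_linearl.
- by rewrite !tens_mul_purel linearP.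
Qed.

Lemma tens_mulE (H : falgType k) (a b c d : H) :
  tens_mul (a \ox b) (c \ox d) = (a * c) \ox (b * d).
Proof.
rewrite tens_mul_purel tens_liftE // => u.
  by apply: tens_linearl; apply: linear_mull.
by apply: tens_linearr; apply: linear_mull.
Qed.

Lemma alg_mulE (H : falgType k) (a b : H) : alg_mul H (a \ox b) = a * b.
Proof.
by rewrite tens_liftE // => c; [apply: linear_mulr | apply: linear_mull].
Qed.

End Tensors.

Section Evaluations.

Variables (k : fieldType) (E : fieldExtType k).

(** This is $f \otimes g$ followed by the multiplication of $E$. *)
Definition tens_ev (U V : vectType k) (f : 'Hom(U, E)) (g : 'Hom(V, E)) :
    'Hom(tensor U V, E) :=
  tens_lift (fun u v => f u * g v).

Definition jointly_injective (U : vectType k) (I : Type)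
    (alpha : I -> 'Hom(U, E)) : Prop :=
  forall u, (forall i, alpha i u = 0) -> u = 0.

(* Equivalently, the [E]-linear extensions of the [alpha i] to [E (x) U] are  *)
(* jointly injective.                                                         *)
Definition coord_free (U : vectType k) (I : Type)
    (alpha : I -> 'Hom(U, E)) : Prop :=
  forall a : 'I_(dim U) -> E,
    (forall i, \sum_j a j * alpha i (Defs.coord_basis j) = 0) ->
  forall j, a j = 0.

Lemma tens_evE (U V : vectType k) (f : 'Hom(U, E)) (g : 'Hom(V, E)) u v :
  tens_ev f g (u \ox v) = f u * g v.
Proof.
rewrite tens_liftE // => w a x y.
  by rewrite linearP mulrDl -scalerAl.
by rewrite linearP mulrDr -scalerAr.
Qed.

Lemma tens_ev_coord (U V : vectType k) (f : 'Hom(U, E)) (g : 'Hom(V, E))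
    (x : tensor U V) :
  tens_ev f g x = \sum_i \sum_j (x : 'M[k]_(dim U, dim V)) i j
    *: (f (Defs.coord_basis i) * g (Defs.coord_basis j)).
Proof. by rewrite lfunE. Qed.

Lemma jointly_injectiveP (U : vectType k) (I : Type)
    (alpha : I -> 'Hom(U, E)) (u v : U) :
  jointly_injective alpha -> (forall i, alpha i u = alpha i v) -> u = v.
Proof.
move=> inj_a uv; apply/eqP; rewrite -subr_eq0; apply/eqP/inj_a => i.
by rewrite linearB /= uv subrr.
Qed.

Lemma coord_basis_free (U : vectType k) (c : 'I_(dim U) -> k) :
  \sum_j c j *: Defs.coord_basis j = 0 -> forall j, c j = 0.
Proof.
move=> /(congr1 v2r); rewrite linear_sum linear0 => c0 j.
have := congr1 (fun x : 'rV_ _ => x 0 j) c0; rewrite mxE summxE => <-.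
rewrite (bigD1 j) //= big1 => [|i ij].
  by rewrite linearZ /= r2vK !mxE !eqxx mulr1 addr0.
by rewrite linearZ /= r2vK !mxE eq_sym (negPf ij) andbF mulr0.
Qed.

Lemma coord_free_inj (U : vectType k) (I : Type) (alpha : I -> 'Hom(U, E)) :
  coord_free alpha -> jointly_injective alpha.
Proof.
move=> free_a u au0; rewrite [u]Defs.coord_basis_sum.
apply: big1 => j _; suff: (v2r u 0 j)%:A = 0 :> E.
  by move/eqP; rewrite scaler_eq0 oner_eq0 orbF => /eqP->; rewrite scale0r.
apply: (free_a (fun j => (v2r u 0 j)%:A)) => i.
rewrite -[RHS](au0 i) {2}[u]Defs.coord_basis_sum linear_sum.
by apply: eq_bigr => l _; rewrite linearZ /= mulr_algl.
Qed.

(** Contracting the second factor of [x] with [beta q] gives coefficients in $E$ of a relation that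
    [coord_free] makes trivial; joint injectivity of [beta] then makes each row of [x] vanish. *)
Lemma tens_ev_injl (U V : vectType k) (I J : Type) (alpha : I -> 'Hom(U, E))
    (beta : J -> 'Hom(V, E)) :
    coord_free alpha -> jointly_injective beta ->
  jointly_injective (fun ij : I * J => tens_ev (alpha ij.1) (beta ij.2)).
Proof.
move=> free_a inj_b x x0; apply/matrixP => i j; rewrite mxE.
apply: (coord_basis_free (c := fun j => (x : 'M_(_, _)) i j)).
apply: inj_b => q; move: i.
pose y i := beta q (\sum_j (x : 'M_(_, _)) i j *: Defs.coord_basis j).
apply: (free_a y) => p.
rewrite -[RHS](x0 (p, q)) tens_ev_coord; apply: eq_bigr => i _.
rewrite /y linear_sum mulr_suml; apply: eq_bigr => l _.
by rewrite linearZ /= -scalerAl mulrC.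
Qed.

(** This variant serves the inclusion of $F$ in $E$, a single injective map that is in general not
    [coord_free]. *)
Lemma tens_ev_injr (U V : vectType k) (I J : Type) (alpha : I -> 'Hom(U, E))
    (beta : J -> 'Hom(V, E)) :
    jointly_injective alpha -> coord_free beta ->
  jointly_injective (fun ij : I * J => tens_ev (alpha ij.1) (beta ij.2)).
Proof.
move=> inj_a free_b x x0; apply/matrixP => i j; rewrite mxE.
apply: (coord_basis_free (c := fun i => (x : 'M_(_, _)) i j)).
apply: inj_a => p; move: j.
pose y j := alpha p (\sum_i (x : 'M_(_, _)) i j *: Defs.coord_basis i).
apply: (free_b y) => q.
rewrite -[RHS](x0 (p, q)) tens_ev_coord exchange_big; apply: eq_bigr => j _.
rewrite /y linear_sum mulr_suml; apply: eq_bigr => l _.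
by rewrite linearZ /= -scalerAl.
Qed.

Definition joint_eval (U : vectType k) (I : finType)
    (alpha : I -> 'Hom(U, E)) (u : U) : {ffun I -> E} := [ffun i => alpha i u].

Lemma joint_eval_linear (U : vectType k) (I : finType)
    (alpha : I -> 'Hom(U, E)) : linear (joint_eval alpha).
Proof. by move=> a u v; apply/ffunP => i; rewrite !ffunE linearP. Qed.

HB.instance Definition _ (U : vectType k) (I : finType)
    (alpha : I -> 'Hom(U, E)) :=
  GRing.isSemilinear.Build k U {ffun I -> E} *:%R (joint_eval alpha)
    (GRing.semilinear_linear (joint_eval_linear alpha)).

(** Lifts chosen one element at a time become linear through the pseudo-inverse of the joint
    evaluation, a right inverse on its image. *)
Lemma lift_along_evals (U V : vectType k) (I : finType)
    (alpha : I -> 'Hom(U, E)) (beta : I -> 'Hom(V, E)) :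
    (forall v, exists u, forall i, alpha i u = beta i v) ->
  exists g : 'Hom(V, U), forall i v, alpha i (g v) = beta i v.
Proof.
move=> lift.
pose A := linfun (joint_eval alpha); pose B := linfun (joint_eval beta).
exists (A^-1 \o B)%VF => i v.
have [u au] := lift v.
have ABv : A u = B v by apply/ffunP => j; rewrite !lfunE /= !ffunE.
have: A ((A^-1 \o B)%VF v) = B v.
  by rewrite comp_lfunE limg_lfunVK // -ABv memv_img ?memvf.
by move/ffunP/(_ i); rewrite lfunE [in X in _ = X]lfunE /= !ffunE.
Qed.

End Evaluations.

(** * Hopf algebras with the coefficients of a group algebra *)

Section FormsOfGroupAlgebras.

Variables (k : fieldType) (E : fieldExtType k).

Lemma tens_ev_linear (U V X : vectType k) (f : 'Hom(U, E)) (g : 'Hom(V, E))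
    (h : X -> tensor U V) :
  linear h -> linear (fun x => tens_ev f g (h x)).
Proof. by move=> hl a x y; rewrite hl linearP. Qed.

Lemma tens_ev_map (U V U' V' : vectType k) (f : 'Hom(U', E)) (g : 'Hom(V', E))
    (p : 'Hom(U, U')) (q : 'Hom(V, V')) x :
  tens_ev f g (tens_map p q x) = tens_ev (f \o p)%VF (g \o q)%VF x.
Proof.
move: x; apply: (tens_ext (W := E)) => [||u v]; try exact: linearP.
  by apply: tens_ev_linear; apply: linearP.
by rewrite tens_mapE !tens_evE !comp_lfunE.
Qed.

Lemma tens_ev_swap (U V : vectType k) (f : 'Hom(U, E)) (g : 'Hom(V, E)) x :
  tens_ev f g (tens_swap V U x) = tens_ev g f x.
Proof.
move: x; apply: (tens_ext (W := E)) => [||u v]; try exact: linearP.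
  by apply: tens_ev_linear; apply: linearP.
by rewrite tens_swapE !tens_evE mulrC.
Qed.

Lemma tens_ev_assoc (U V W : vectType k) (f : 'Hom(U, E)) (g : 'Hom(V, E))
    (h : 'Hom(W, E)) x :
  tens_ev f (tens_ev g h) (tens_assoc U V W x) = tens_ev (tens_ev f g) h x.
Proof.
move: x; apply: (tens_ext (W := E)) => [||x w]; try exact: linearP.
  by apply: tens_ev_linear; apply: linearP.
rewrite tens_evE; move: x.
apply: (tens_ext (f := fun x => tens_ev f _ (tens_assoc U V W (x \ox w))) 
  (g := fun x => tens_ev f g x * h w)) => [||u v].
- apply: tens_ev_linear => a x y.
  by rewrite (tens_linearl (f := id)) ?linearP // => ? ? ?.
- by move=> a x y; rewrite linearP mulrDl scalerAl.
- by rewrite tens_assocE !tens_evE mulrA.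
Qed.

Lemma tens_ev0l (U V : vectType k) (g : 'Hom(V, E)) (x : tensor U V) :
  tens_ev 0 g x = 0.
Proof.
rewrite tens_ev_coord big1 // => i _; rewrite big1 // => j _.
by rewrite zero_lfunE mul0r scaler0.
Qed.

Lemma tens_ev0r (U V : vectType k) (f : 'Hom(U, E)) (x : tensor U V) :
  tens_ev f 0 x = 0.
Proof.
rewrite tens_ev_coord big1 // => i _; rewrite big1 // => j _.
by rewrite zero_lfunE mulr0 scaler0.
Qed.

Lemma sum_pred1_mul (I : finType) (i : I) (F : I -> E) :
  \sum_j (j == i)%:R * F j = F i.
Proof.
rewrite (bigD1 i) //= eqxx mul1r big1 ?addr0 // => j /negPf->.
by rewrite mul0r.
Qed.

Variables (H : falgType k) (N : finGroupType) (alpha : N -> 'Hom(H, E)).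
Hypothesis free_alpha : coord_free alpha.
Hypothesis alpha1 : forall n, alpha n 1 = (n == 1%g)%:R.
Hypothesis alphaM : forall n g h,
  alpha n (g * h) = \sum_m alpha m g * alpha (m^-1 * n)%g h.
Hypothesis ex_comul : forall h, exists t, forall n m,
  tens_ev (alpha n) (alpha m) t = (n == m)%:R * alpha n h.
Hypothesis ex_counit : forall h, \sum_n alpha n h \in 1%VS.
Hypothesis ex_antipode : forall h, exists h', forall n,
  alpha n h' = alpha n^-1%g h.

Let inj_alpha := coord_free_inj free_alpha.
Let inj_alpha2 := tens_ev_injl free_alpha inj_alpha.
Let inj_alpha3 := tens_ev_injl free_alpha inj_alpha2.

Let alpha_mul n x :
  alpha n (alg_mul H x) = \sum_m tens_ev (alpha m) (alpha (m^-1 * n)%g) x.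
Proof.
move: x; apply: (tens_ext (W := E)) => [a x y|a x y|g h].
- by rewrite !linearP.
- rewrite scaler_sumr -big_split; apply: eq_bigr => m _.
  exact: linearP.
- by rewrite alg_mulE alphaM; apply: eq_bigr => m _; rewrite tens_evE.
Qed.

Let alpha_tens_mul n m x y :
  tens_ev (alpha n) (alpha m) (tens_mul x y) =
  \sum_p \sum_q tens_ev (alpha p) (alpha q) x
    * tens_ev (alpha (p^-1 * n)%g) (alpha (q^-1 * m)%g) y.
Proof.
move: x; apply: (tens_ext (W := E)) => [|a x z|a b].
- by apply: tens_ev_linear; apply: tens_mul_linearl.
- rewrite scaler_sumr -big_split; apply: eq_bigr => p _.
  rewrite scaler_sumr -big_split; apply: eq_bigr => q _ /=.
  by rewrite linearP mulrDl scalerAl.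
move: y; apply: (tens_ext (W := E)) => [|e x z|c d].
- by apply: tens_ev_linear; apply: tens_mul_linearr.
- rewrite scaler_sumr -big_split; apply: eq_bigr => p _.
  rewrite scaler_sumr -big_split; apply: eq_bigr => q _ /=.
  by rewrite linearP mulrDr scalerAr.
rewrite tens_mulE tens_evE !alphaM mulr_suml; apply: eq_bigr => p _.
rewrite mulr_sumr; apply: eq_bigr => q _.
by rewrite !tens_evE mulrACA.
Qed.

(** In $E[N]$ every [n] is group-like, the counit sums the coefficients and the antipode inverts the
    index; the three existence hypotheses say that these operations are defined over [H]. Identities
    in $H$, $H \otimes H$ and $H \otimes H \otimes H$ are compared on coefficients, which are
    jointly injective there. *)
Lemma form_of_group_algebra_hopf :
  exists (Delta : 'Hom(H, tensor H H)) (eps : 'Hom(H, k^o)) (S : 'End(H)),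
    [/\ is_hopf_algebra Delta eps S, cocommutative Delta,
      forall h n m,
        tens_ev (alpha n) (alpha m) (Delta h) = (n == m)%:R * alpha n h
    & forall h, (eps h : k)%:A = \sum_n alpha n h].
Proof.
have [|Delta Delta_nm] := lift_along_evals
    (alpha := fun nm : N * N => tens_ev (alpha nm.1) (alpha nm.2))
    (beta := fun nm => if nm.1 == nm.2 then alpha nm.1 else 0).
  move=> h; have [t t_nm] := ex_comul h; exists t => -[n m] /=.
  by rewrite t_nm; case: eqP => _; rewrite ?mul1r ?mul0r ?zero_lfunE.
have DeltaE n m h :
    tens_ev (alpha n) (alpha m) (Delta h) = (n == m)%:R * alpha n h.
  rewrite (Delta_nm (n, m)) /=.
  by case: eqP => _; rewrite ?mul1r ?mul0r ?zero_lfunE.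
have Delta_lf n m : (tens_ev (alpha n) (alpha m) \o Delta)%VF
    = if n == m then alpha n else 0.
  by apply/lfunP => h; rewrite comp_lfunE (Delta_nm (n, m)).
have kA_linear : linear (fun a : k^o => (a : k)%:A : E).
  by move=> a b c; rewrite scalerDl scalerA.
pose kA := GRing.isLinear.Build k k^o E *:%R _ kA_linear.
pose KA : {linear k^o -> E} := HB.pack (fun a : k^o => (a : k)%:A : E) kA.
have [|eps eps_n] := lift_along_evals
    (alpha := fun _ : unit => linfun KA)
    (beta := fun _ => \sum_n alpha n).
  move=> h; have /vlineP[a aE] := ex_counit h; exists a => _.
  by rewrite lfunE /= -aE sum_lfunE.
have epsE h : (eps h : k)%:A = \sum_n alpha n h.
  by have := eps_n tt h; rewrite lfunE sum_lfunE.
have kA_inj : injective (fun a : k => a%:A : E).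
  exact: (fmorph_inj (in_alg E)).
have [S SE] := lift_along_evals (alpha := alpha) ex_antipode.
have S_lf n : (alpha n \o S)%VF = alpha n^-1%g.
  by apply/lfunP => h; rewrite comp_lfunE SE.
exists Delta, eps, S; split=> //; last first.
  move=> h; apply: (jointly_injectiveP inj_alpha2) => -[n m] /=.
  rewrite tens_ev_swap !DeltaE eq_sym; case: eqP => [->|] //.
  by rewrite !mul0r.
split.
- move=> h; apply: (jointly_injectiveP inj_alpha3) => -[a [b c]] /=.
  (* Both sides have coefficient [alpha a h] where [a], [b], [c] agree, and zero elsewhere. *)
  rewrite tens_ev_assoc !tens_ev_map !comp_lfun1r !Delta_lf.
  case: (eqVneq a b) => [<-|ab]; case: (eqVneq _ c) => [<-|bc] //.
  + by rewrite tens_ev0r DeltaE (negPf bc) mul0r.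
  + by rewrite tens_ev0l DeltaE (negPf ab) mul0r.
  + by rewrite tens_ev0l tens_ev0r.
- move=> h; split; apply: (jointly_injectiveP inj_alpha) => n.
    transitivity (\sum_m tens_ev (alpha m) (alpha n) (Delta h)).
      move: (Delta h); apply: (tens_ext (W := E)) => [a x y|a x y|g l].
      + by rewrite !linearP.
      + rewrite scaler_sumr -big_split; apply: eq_bigr => m _.
        exact: linearP.
      rewrite tens_liftE => [|v a x y|u]; last exact: linearP.
        rewrite linearZ /= -mulr_algl epsE mulr_suml.
        by apply: eq_bigr => m _; rewrite tens_evE.
      by rewrite linearP /= scalerDl scalerA.
    under eq_bigr do rewrite DeltaE.
    by rewrite (sum_pred1_mul n (fun m => alpha m h)).
  transitivity (\sum_m tens_ev (alpha n) (alpha m) (Delta h)).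
    move: (Delta h); apply: (tens_ext (W := E)) => [a x y|a x y|g l].
    + by rewrite !linearP.
    + rewrite scaler_sumr -big_split; apply: eq_bigr => m _.
      exact: linearP.
    rewrite tens_liftE => [|v|u a x y]; last 1 first.
    + by rewrite linearP /= scalerDl scalerA.
    + rewrite linearZ /= -mulr_algr epsE mulr_sumr.
      by apply: eq_bigr => m _; rewrite tens_evE.
    + exact: linearP.
  under eq_bigr do rewrite DeltaE eq_sym.
  by rewrite (sum_pred1_mul n (fun m => alpha n h)).
- split=> [|a b]; apply: (jointly_injectiveP inj_alpha2) => -[n m] /=.
    rewrite DeltaE tens_evE !alpha1.
    case: (eqVneq n 1%g) => [->|_]; rewrite ?mulr0 ?mul0r //.
    by rewrite mul1r mulr1 eq_sym.
  rewrite DeltaE alpha_tens_mul alphaM mulr_sumr; apply: eq_bigr => p _.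
  rewrite (bigD1 p) //= big1 ?addr0 => [|q /negPf qp]; rewrite !DeltaE.
    rewrite eqxx mul1r; case: (eqVneq n m) => [->|nm].
      by rewrite eqxx !mul1r.
    by rewrite (inj_eq (mulgI _)) (negPf nm) !mul0r mulr0.
  by rewrite eq_sym qp !mul0r.
- split=> [|a b]; apply: kA_inj => /=; rewrite epsE.
    under eq_bigr do rewrite alpha1 -[_%:R]mulr1.
    by rewrite (sum_pred1_mul _ (fun=> 1)) scale1r.
  transitivity ((eps a : k)%:A * (eps b : k)%:A : E); last first.
    by rewrite mulr_algl scalerA.
  rewrite !epsE mulr_suml; under eq_bigr do rewrite alphaM.
  rewrite exchange_big; apply: eq_bigr => m _ /=.
  rewrite -mulr_sumr; congr (_ * _).
  by rewrite [RHS](reindex_inj (mulgI m^-1%g)).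
- move=> h.
  have alpha_eps n : alpha n (eps h : k)%:A = (n == 1%g)%:R * \sum_m alpha m h.
    by rewrite linearZ /= alpha1 -mulr_algr epsE.
  split; apply: (jointly_injectiveP inj_alpha) => n.
    (* [Delta h] is supported on the diagonal, so the term of index [m] survives only if $m^{-1} =
       m^{-1} n$, that is $n = 1$. *)
    rewrite alpha_mul alpha_eps mulr_sumr.
    rewrite [RHS](reindex_inj invg_inj) /=; apply: eq_bigr => m _.
    rewrite tens_ev_map comp_lfun1r S_lf DeltaE -{1}[(m^-1)%g]mulg1.
    by rewrite (inj_eq (mulgI _)) eq_sym.
  rewrite alpha_mul alpha_eps mulr_sumr; apply: eq_bigr => m _.
  rewrite tens_ev_map comp_lfun1r S_lf DeltaE invMg invgK -{1}[m]mul1g.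
  by rewrite (inj_eq (mulIg _)) eq_sym -eq_invg1 invgK.
Qed.

End FormsOfGroupAlgebras.

(** * Galois descent *)

Section GaloisDescent.

Variables (k : fieldType) (E : splittingFieldType k).
Hypothesis galE : galois 1%VS {:E}.

Lemma mem_gal1 (x : gal_of {:E}) : x \in 'Gal({:E} / 1)%g.
Proof. by rewrite gal_kHom ?sub1v // k1AHom. Qed.

Lemma trace_mem1 (e : E) : \sum_(x : gal_of {:E}) x e \in 1%VS.
Proof.
have := mem_galTrace galE (memvf e); rewrite /galTrace.
by under eq_bigl do rewrite mem_gal1.
Qed.

Lemma fixed_mem1 (e : E) : (forall x : gal_of {:E}, x e = e) -> e \in 1%VS.
Proof.
move=> fix_e; have /galois_fixedField <- := galE.
by apply/fixedFieldP=> [|x _]; rewrite ?memvf.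
Qed.

(** Dedekind's independence of automorphisms. *)
Lemma gal_free (c : gal_of {:E} -> E) :
  (forall e, \sum_x c x * x e = 0) -> forall x, c x = 0.
Proof.
by move=> c0 x; apply: (gal_independent (P := predT) (c_ := c)).
Qed.

Variables (X : finType) (to : {action gal_of {:E} &-> X}).

(** A linear map whose kernel consists of the equivariant functions, which makes them a subspace. *)
Definition equivariance_defect (f : {ffun X -> E}) :
    {ffun gal_of {:E} * X -> E} :=
  [ffun p => f (to p.2 p.1) - p.1 (f p.2)].

Lemma equivariance_defect_linear : linear equivariance_defect.
Proof.
move=> a f g; apply/ffunP => p; rewrite !ffunE linearP.
by rewrite scalerBr opprD addrACA.
Qed.

HB.instance Definition _ :=
  GRing.isSemilinear.Build k {ffun X -> E} {ffun gal_of {:E} * X -> E} *:%R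
    equivariance_defect
    (GRing.semilinear_linear equivariance_defect_linear).

Definition equivariants : {vspace {ffun X -> E}} :=
  lker (linfun equivariance_defect).

Lemma equivariantsP (f : {ffun X -> E}) :
  reflect (forall n x, f (to n x) = x (f n)) (f \in equivariants).
Proof.
rewrite memv_ker lfunE; apply: (iffP eqP) => [/ffunP f0 n x | eq_f].
  by have := f0 (x, n); rewrite !ffunE => /eqP; rewrite subr_eq0 => /eqP.
by apply/ffunP => -[x n]; rewrite !ffunE eq_f subrr.
Qed.

Lemma linfun_linearE (U V : vectType k) (f : U -> V) :
  linear f -> linfun f =1 f.
Proof.
move=> fl; pose fL := GRing.isLinear.Build k U V *:%R f fl.
by pose FL : {linear U -> V} := HB.pack f fL; apply: (lfunE FL).
Qed.

Definition equivariant_space : vectType k := subvs_of equivariants.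

Definition eval_at (n : X) : 'Hom(equivariant_space, E) :=
  linfun (fun f : subvs_of equivariants => (vsval f : {ffun X -> E}) n).

Lemma eval_atE n (f : equivariant_space) :
  eval_at n f = (vsval (f : subvs_of equivariants) : {ffun X -> E}) n.
Proof. by apply: linfun_linearE => a g h; rewrite linearP !ffunE. Qed.

Lemma eval_at_equivariant n x f : eval_at (to n x) f = x (eval_at n f).
Proof. by rewrite !eval_atE; apply/equivariantsP/subvsP. Qed.

(* From an [E]-linear relation with coefficients [a j], applying [x] and      *)
(* summing over the Galois group gives the relations with coefficients the    *)
(* traces of [e * a j], which lie in [k] and hence vanish for all [e].        *)
Lemma equivariant_coord_free (V : vectType k) (alpha : X -> 'Hom(V, E)) :
    jointly_injective alpha ->
    (forall n x v, alpha (to n x) v = x (alpha n v)) ->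
  coord_free alpha.
Proof.
move=> inj_a eq_a a a0 j.
suff tr0 e : \sum_(x : gal_of {:E}) x (e * a j) = 0.
  have/(_ 1%g)/eqP: forall x : gal_of {:E}, x (a j) = 0.
    apply: gal_free => e; rewrite -[RHS](tr0 e); apply: eq_bigr => x _.
    by rewrite rmorphM mulrC.
  by rewrite fmorph_eq0 => /eqP.
have /all_sig[c cE] i : {c : k | \sum_(x : gal_of {:E}) x (e * a i) = c%:A}.
  by apply/sig_eqW/vlineP/trace_mem1.
rewrite cE (_ : c j = 0) ?scale0r //; move: j.
apply: (coord_basis_free (U := V)); apply: inj_a => n.
rewrite linear_sum.
under eq_bigr => i _ do rewrite linearZ /= -mulr_algl -cE mulr_suml.
rewrite exchange_big big1 // => x _.
transitivity (x e * x (\sum_i a i * alpha (to n x^-1)%g (Defs.coord_basis i))).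
  rewrite rmorph_sum mulr_sumr; apply: eq_bigr => i _.
  by rewrite !rmorphM /= -eq_a actKV mulrA.
by have -> := a0 (to n x^-1)%g; rewrite rmorph0 mulr0.
Qed.

Lemma eval_at_inj : jointly_injective eval_at.
Proof.
by move=> f f0; apply/val_inj/ffunP => n; rewrite -eval_atE f0 ffunE.
Qed.

Lemma eval_at_free : coord_free eval_at.
Proof.
by apply: equivariant_coord_free eval_at_inj _; apply: eval_at_equivariant.
Qed.

(** The matrix of evaluations on a basis has rank equal to both of its dimensions: its rows are
    independent by [eval_at_free], its columns by testing a relation on functions supported on one
    orbit. *)
Lemma dim_equivariants : \dim equivariants = #|X|.
Proof.
pose P := \matrix_(j < dim equivariant_space, i < #|X|)
  eval_at (enum_val i) (Defs.coord_basis j).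
have freeP : row_free P.
  apply/inj_row_free => v vP0; apply/rowP => j; rewrite [RHS]mxE.
  apply: (eval_at_free (a := fun j => v 0 j)) => n.
  have := congr1 (fun u : 'rV_ _ => u 0 (enum_rank n)) vP0; rewrite !mxE => vn.
  rewrite -[RHS]vn; apply: eq_bigr => i _; by rewrite !mxE enum_rankK.
have freePt : row_free P^T.
  apply/inj_row_free => v vP0; apply/rowP => i; rewrite [RHS]mxE.
  have v0 f : \sum_i v 0 i * eval_at (enum_val i) f = 0.
    rewrite [f]Defs.coord_basis_sum.
    under eq_bigr do rewrite linear_sum mulr_sumr.
    rewrite exchange_big big1 // => j _.
    have := congr1 (fun u : 'rV_ _ => u 0 j) vP0; rewrite !mxE => vj.
    transitivity (v2r f 0 j *: \sum_i v 0 i * P^T i j); last first.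
      by rewrite vj scaler0.
    rewrite scaler_sumr.
    by apply: eq_bigr => l _; rewrite linearZ !mxE /= scalerAr.
  pose n0 := enum_val i.
  suff: forall x : gal_of {:E}, v 0 (enum_rank (to n0 x)) = 0.
    by move/(_ 1%g); rewrite act1 enum_valK.
  apply: gal_free => e.
  (* Spreading [e] over the orbit of [n0] turns the relation [v0] into one among automorphisms. *)
  pose f := [ffun n => \sum_(x | to n0 x == n) x e].
  have Wf : f \in equivariants.
    apply/equivariantsP => n y; rewrite !ffunE rmorph_sum.
    rewrite (reindex_inj (mulIg y)) /=; apply: eq_big => [x|x _].
      by rewrite actM (inj_eq (act_inj _ _)).
    by rewrite galM ?memvf.
  rewrite -[RHS](v0 (Subvs Wf)).
  rewrite (partition_big (fun x => enum_rank (to n0 x)) predT) //=.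
  apply: eq_bigr => l _; rewrite eval_atE /= ffunE mulr_sumr.
  by apply: eq_big => [x|x /eqP->] //; rewrite (can2_eq enum_rankK enum_valK).
move: freeP freePt; rewrite /row_free mxrank_tr => /eqP-> /eqP.
by [].
Qed.

(** The joint evaluation embeds [V] into the equivariant functions, and the dimensions agree. *)
Lemma equivariant_onto (V : vectType k) (alpha : X -> 'Hom(V, E)) :
    jointly_injective alpha ->
    (forall n x v, alpha (to n x) v = x (alpha n v)) ->
    dim V = #|X| ->
  forall f : X -> E, (forall n x, f (to n x) = x (f n)) ->
  exists v, forall n, alpha n v = f n.
Proof.
move=> inj_a eq_a dimV f eq_f.
pose A := linfun (joint_eval alpha).
have kerA : lker A == 0%VS.
  apply/lker0P => u v /ffunP uv; apply: (jointly_injectiveP inj_a) => n.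
  by have := uv n; rewrite !lfunE !ffunE.
have imA : limg A = equivariants.
  apply/eqP; rewrite eqEdim dim_equivariants; apply/andP; split.
    apply/subvP => _ /memv_imgP[v _ ->]; apply/equivariantsP => n x.
    by rewrite lfunE !ffunE eq_a.
  by rewrite limg_dim_eq ?(eqP kerA) ?capv0 // dimvf dimV.
have : [ffun n => f n] \in limg A.
  by rewrite imA; apply/equivariantsP => n x; rewrite !ffunE eq_f.
case/memv_imgP=> v _ /ffunP fv; exists v => n.
by have := fv n; rewrite lfunE !ffunE.
Qed.

End GaloisDescent.

(** * Algebras of operators under composition *)

Section CompositionAlgebra.

Variables (k : fieldType) (L : falgType k) (U : {vspace 'End(L)}).

(* The ring structure of [FalgLfun] on ['End(L)] multiplies in the opposite   *)
(* order, [f * g = g \o f], while an action of [H] needs [g * h] to act as    *)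
(* [g \o h].                                                                  *)
Definition comp_algebra (U1 : \1%VF \in U)
    (UM : {in U &, forall f g, (f \o g)%VF \in U}) : Type :=
  subvs_of U.

Variables (U1 : \1%VF \in U) (UM : {in U &, forall f g, (f \o g)%VF \in U}).

Local Notation A := (comp_algebra U1 UM).

HB.instance Definition _ := Vector.on A.

Definition operator (f : A) : 'End(L) := vsval f.

Lemma operator_inj : injective operator.
Proof. exact: val_inj. Qed.

Lemma operator_linear : linear operator.
Proof. exact: linearP. Qed.

Definition comp_mul (f g : A) : A := Subvs (UM (subvsP f) (subvsP g)).
Definition comp_one : A := Subvs U1.

Fact comp_mulA : associative comp_mul.
Proof. by move=> f g h; apply/val_inj/comp_lfunA. Qed.

Fact comp_mul1l : left_id comp_one comp_mul.
Proof. by move=> f; apply/val_inj/comp_lfun1l. Qed.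

Fact comp_mul1r : right_id comp_one comp_mul.
Proof. by move=> f; apply/val_inj/comp_lfun1r. Qed.

Fact comp_mulDl : left_distributive comp_mul +%R.
Proof. by move=> f g h; apply/val_inj/comp_lfunDl. Qed.

Fact comp_mulDr : right_distributive comp_mul +%R.
Proof. by move=> f g h; apply/val_inj/comp_lfunDr. Qed.

Fact comp_one_neq0 : comp_one != 0.
Proof.
apply/eqP => /(congr1 operator) /lfunP/(_ 1)/eqP.
by rewrite id_lfunE zero_lfunE oner_eq0.
Qed.

HB.instance Definition _ := GRing.Zmodule_isNzRing.Build A
  comp_mulA comp_mul1l comp_mul1r comp_mulDl comp_mulDr comp_one_neq0.

Fact comp_scaleAl (a : k) (f g : A) : a *: (f * g) = (a *: f) * g.
Proof. exact/val_inj/comp_lfunZl. Qed.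

HB.instance Definition _ := GRing.Lmodule_isLalgebra.Build k A comp_scaleAl.

Fact comp_scaleAr (a : k) (f g : A) : a *: (f * g) = f * (a *: g).
Proof. exact/val_inj/comp_lfunZr. Qed.

HB.instance Definition _ := GRing.Lalgebra_isAlgebra.Build k A comp_scaleAr.

HB.instance Definition _ := Algebra_isFalgebra.Build k A.

End CompositionAlgebra.

(** * Hopf Galois structures from cocycles *)

Section HopfGaloisFromCocycle.

Variables (k : fieldType) (E : splittingFieldType k) (F : {subfield E}).
Hypothesis galE : galois 1%VS {:E}.

(* As [(x * y) a = y (x a)] in [gal_of], the action on [N] is a right action, *)
(* and the fibres of [pi] are the right cosets of ['Gal({:E} / F)].           *)
Variables (N : finGroupType) (to : {action gal_of {:E} &-> N}).
Variable pi : gal_of {:E} -> N.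
Hypothesis toM : forall m n x, to (m * n)%g x = (to m x * to n x)%g.
Hypothesis piM : forall x y, pi (x * y)%g = (pi y * to (pi x) y)%g.
Hypothesis pi_onto : forall n, exists x, pi x = n.
Hypothesis pi_eq1 : forall x, (pi x == 1%g) = (x \in 'Gal({:E} / F)%g).

Let L : fieldExtType k := subvs_of F.

Let vsval_inj (a b : L) : vsval a = vsval b -> a = b.
Proof. exact: val_inj. Qed.

Let to1 x : to 1%g x = 1%g.
Proof. by apply: (mulgI (to 1%g x)); rewrite -toM !mulg1. Qed.

Let toV n x : to n^-1%g x = (to n x)^-1%g.
Proof. by apply/eqP; rewrite eq_sym eq_invg_mul -toM mulgV to1. Qed.

Let pi1 : pi 1%g = 1%g.
Proof. by apply/eqP; rewrite pi_eq1 group1. Qed.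

(** A representative of the fibre over [n]; the default is never reached, since [pi] is onto. *)
Let tau n : gal_of {:E} := odflt 1%g [pick x | pi x == n].

Let tauK n : pi (tau n) = n.
Proof.
rewrite /tau; case: pickP => [x /eqP|] //=.
by have [x <-] := pi_onto n => /(_ x); rewrite eqxx.
Qed.

(** By the cocycle identity [pi] is 1 at $x y^{-1}$, which therefore fixes $F$. Hence the
    restriction of [tau n] to $F$ depends only on [n]. *)
Let pi_fiber x y a : pi x = pi y -> a \in F -> x a = y a.
Proof.
move=> pi_xy Fa; have: (x * y^-1)%g \in 'Gal({:E} / F)%g.
  rewrite -pi_eq1; apply/eqP/(act_inj to y)/(mulgI (pi y)).
  by rewrite -piM mulgKV to1 mulg1.
move=> xy; rewrite -{1}[x](mulgKV y) galM ?memvf //; congr (y _).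
exact: fixed_gal (subvf F) xy Fa.
Qed.

(** On traces from $E$ to $F$, a relation among the embeddings with coefficients [c] becomes one
    among automorphisms with coefficients [c \o pi]. *)
Let tau_free (c : N -> E) :
  (forall a : L, \sum_n c n * tau n (vsval a) = 0) -> forall n, c n = 0.
Proof.
move=> c0 n; rewrite -[n]tauK; move: (tau n) => {n}.
apply: (gal_free (c := c \o pi)) => e.
have Ftr : galTrace F {:E} e \in F.
  by apply: mem_galTrace; rewrite ?memvf // (galoisS _ galE) ?sub1v ?subvf.
rewrite -[RHS](c0 (Subvs Ftr)) (partition_big pi predT) //=.
apply: eq_bigr => n _; rewrite rmorph_sum mulr_sumr.
rewrite (reindex_inj (mulIg (tau n))) /=; apply: eq_big => [x|x /eqP xn].
  by rewrite piM tauK -(inj_eq (mulgI n^-1%g)) mulKg mulVg -(to1 (tau n))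
       (inj_eq (act_inj _ _)) pi_eq1.
by rewrite xn galM ?memvf.
Qed.

Let W : vectType k := equivariant_space to.
Let c n : 'Hom(W, E) := eval_at to n.
Let c_act n x f : c (to n x) f = x (c n f).
Proof. exact: eval_at_equivariant. Qed.

(** An [x] fixing $F$ permutes the summands: as [pi x = 1], the index of [tau n * x] is [to n x],
    and [x] moves the coefficient at [n] to the one at [to n x]. *)
Let rho_mem (f : W) (a : L) : \sum_n c n f * tau n (vsval a) \in F.
Proof.
have galF : galois F {:E} by rewrite (galoisS _ galE) ?sub1v ?subvf.
suff: \sum_n c n f * tau n (vsval a) \in fixedField 'Gal({:E} / F)%g.
  by rewrite (galois_fixedField galF).
apply/fixedFieldP=> [|x]; rewrite ?memvf //.
rewrite -pi_eq1 => /eqP pix.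
rewrite rmorph_sum [RHS](reindex_inj (act_inj to x)).
apply: eq_bigr => n _; rewrite rmorphM c_act; congr (_ * _).
rewrite -[LHS]/(x (tau n (vsval a))) -galM ?memvf //.
apply: pi_fiber (subvsP a).
by rewrite piM pix mul1g !tauK.
Qed.

Let rho_fun (f : W) (a : L) : L := Subvs (rho_mem f a).

Let rho_fun_linear f : linear (rho_fun f).
Proof.
move=> b u v; apply: vsval_inj; rewrite /= scaler_sumr -big_split.
by apply: eq_bigr => n _; rewrite linearP mulrDr scalerAr.
Qed.

Let rho (f : W) : 'End(L) := linfun (rho_fun f).

Let rhoE f a : vsval (rho f a) = \sum_n c n f * tau n (vsval a).
Proof. by rewrite (linfun_linearE (rho_fun_linear f)). Qed.

Let rho_linear : linear rho.
Proof.
move=> b f g; apply/lfunP => a; apply: vsval_inj.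
rewrite !lfun_simp !linearP /= !rhoE scaler_sumr -big_split.
by apply: eq_bigr => n _; rewrite linearP mulrDl scalerAl.
Qed.

Let rho_lf := linfun rho.

Let rho_lfE f : rho_lf f = rho f.
Proof. exact: (linfun_linearE rho_linear). Qed.

(** Composition is convolution of coefficients: [tau n * tau m] has index [m * to n (tau m)], and
    [tau m] moves the coefficient of [g] at [n] to the one at [to n (tau m)]. *)
Let rho_comp f g : exists h, (rho f \o rho g)%VF = rho h /\
  forall n, c n h = \sum_m c m f * c (m^-1 * n)%g g.
Proof.
have [|h hE] := equivariant_onto galE (eval_at_inj (to := to)) c_act
    (dim_equivariants galE to) (f := fun n => \sum_m c m f * c (m^-1 * n)%g g).
  move=> n x; rewrite (reindex_inj (act_inj to x)) rmorph_sum.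
  apply: eq_bigr => m _; rewrite rmorphM /= -!c_act; congr (_ * c _ g).
  by rewrite toM toV.
exists h; split=> //; apply/lfunP => a; apply: vsval_inj.
rewrite comp_lfunE !rhoE.
under eq_bigr => m _.
  rewrite rmorph_sum mulr_sumr /=.
  under eq_bigr => n _.
    rewrite rmorphM /= -c_act -galM ?memvf //.
    rewrite (_ : (tau n * tau m)%g _ =
      tau (m * to n (tau m))%g (vsval a)); last first.
      by apply: pi_fiber (subvsP a); rewrite piM !tauK.
    over.
  over.
under [RHS]eq_bigr do rewrite hE mulr_suml.
rewrite [RHS]exchange_big; apply: eq_bigr => m _ /=.
rewrite [RHS](reindex_inj (mulgI m)) [RHS](reindex_inj (act_inj to (tau m))).
by apply: eq_bigr => n _; rewrite mulKg mulrA.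
Qed.

Let rho_1 : exists f, rho f = \1%VF /\ forall n, c n f = (n == 1%g)%:R.
Proof.
have [|f fE] := equivariant_onto galE (eval_at_inj (to := to)) c_act
    (dim_equivariants galE to) (f := fun n => (n == 1%g)%:R).
  move=> n x; rewrite rmorph_nat -{1}(to1 x).
  by rewrite (inj_eq (act_inj _ _)).
exists f; split=> //; apply/lfunP => a; apply: vsval_inj.
rewrite rhoE id_lfunE; under eq_bigr do rewrite fE.
rewrite (sum_pred1_mul 1%g (fun n => tau n (vsval a))).
by rewrite (pi_fiber (y := 1%g) _ (subvsP a)) ?gal_id // tauK pi1.
Qed.

Let rho_im1 : \1%VF \in limg rho_lf.
Proof. by have [f [<- _]] := rho_1; rewrite -rho_lfE memv_img ?memvf. Qed.

Let rho_imM : {in limg rho_lf &, forall f g, (f \o g)%VF \in limg rho_lf}.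
Proof.
move=> _ _ /memv_imgP[f _ ->] /memv_imgP[g _ ->].
have [h [hE _]] := rho_comp f g.
by rewrite !rho_lfE hE -rho_lfE memv_img ?memvf.
Qed.

(** $E[N]^G$ is replaced by its image in ['End(L)], so that the ring axioms come from
    composition. *)
Let H : falgType k := comp_algebra rho_im1 rho_imM.

Let opval (h : H) : 'End(L) := operator (h : comp_algebra _ _).

Let opval_linear : linear opval.
Proof. exact: operator_linear. Qed.

(** Coefficients are read off through the pseudo-inverse of [rho_lf]; by [tau_free] the operator
    determines them. *)
Let alpha n : 'Hom(H, E) := (c n \o (rho_lf^-1 \o linfun opval))%VF.

Let opE h a : vsval (opval h a) = \sum_n alpha n h * tau n (vsval a).
Proof.
have -> : opval h = rho (rho_lf^-1 (opval h))%VF.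
  by rewrite -rho_lfE limg_lfunVK // subvsP.
rewrite rhoE; apply: eq_bigr => n _.
by rewrite !comp_lfunE (linfun_linearE opval_linear).
Qed.

Let alpha_uniq (h : H) f :
    (forall a : L, vsval (opval h a) = \sum_n f n * tau n (vsval a)) ->
  forall n, alpha n h = f n.
Proof.
move=> hE n; apply/eqP; rewrite -subr_eq0; apply/eqP.
apply: (tau_free (c := fun n => alpha n h - f n)) => a.
under eq_bigr do rewrite mulrBl.
by rewrite sumrB -opE -hE subrr.
Qed.

Let alpha_inj : jointly_injective alpha.
Proof.
move=> h h0; apply: operator_inj; apply/lfunP => a; apply: vsval_inj.
rewrite [LHS]opE big1 => [|n _]; last by rewrite h0 mul0r.
by rewrite zero_lfunE.
Qed.

Let alpha_act n x h : alpha (to n x) h = x (alpha n h).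
Proof. by rewrite !comp_lfunE c_act. Qed.

Let alpha_free : coord_free alpha.
Proof. by apply: equivariant_coord_free alpha_inj alpha_act. Qed.

Let alpha1 n : alpha n 1 = (n == 1%g)%:R.
Proof.
have [f [f1 fE]] := rho_1.
apply: (alpha_uniq (f := fun n => (n == 1%g)%:R)) => a.
under eq_bigr do rewrite -fE.
by rewrite -rhoE f1.
Qed.

Let alphaM n g h :
  alpha n (g * h) = \sum_m alpha m g * alpha (m^-1 * n)%g h.
Proof.
have rhoV l : opval l = rho (rho_lf^-1 (opval l))%VF.
  by rewrite -rho_lfE limg_lfunVK // subvsP.
have alphaE m l : alpha m l = c m (rho_lf^-1 (opval l))%VF.
  by rewrite !comp_lfunE (linfun_linearE opval_linear).
have [f [fE cf]] := rho_comp (rho_lf^-1 (opval g))%VF (rho_lf^-1 (opval h))%VF.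
under eq_bigr do rewrite !alphaE; rewrite -cf.
apply: (alpha_uniq (f := fun n => c n f)) => a.
by rewrite -rhoE -fE -!rhoV.
Qed.

Let dimH : dim H = #|N|.
Proof.
rewrite -(dim_equivariants galE to) -[LHS]/(\dim (limg rho_lf)).
rewrite limg_dim_eq; first by rewrite dimvf.
apply/eqP; rewrite capfv; apply/lker0P => f g; rewrite !rho_lfE => fg.
apply: (jointly_injectiveP (eval_at_inj (to := to))) => n.
apply/eqP; rewrite -subr_eq0; apply/eqP.
apply: (tau_free (c := fun n => c n f - c n g)) => a.
under eq_bigr do rewrite mulrBl.
by rewrite sumrB -!rhoE fg subrr.
Qed.

(** The componentwise action governs the coefficients of $H \otimes H$. *)
Let to2 (p : N * N) (x : gal_of {:E}) := (to p.1 x, to p.2 x).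

Let to2_1 : to2^~ 1%g =1 id.
Proof. by case=> m n; rewrite /to2 /= !act1. Qed.

Let to2_M p : act_morph to2 p.
Proof. by move=> x y; rewrite /to2 /= !actM. Qed.

(** All fibres of [pi] have the size of $Gal(E/F)$, so [#|N|] is its index. *)
Let dimF : dim L = #|N|.
Proof.
rewrite -[LHS]/(\dim F).
have galF : galois F {:E} by rewrite (galoisS _ galE) ?sub1v ?subvf.
have /esym/eqP := galois_dim galF.
rewrite eqn_div ?adim_gt0 ?field_dimS ?subvf //.
have := galois_dim galE; rewrite dimv1 divn1 => ->.
have -> : #|'Gal({:E} / 1)%g| = (#|N| * #|'Gal({:E} / F)%g|)%N.
  rewrite (eq_card (B := predT)); last by move=> x; rewrite mem_gal1.
  rewrite -sum1_card (partition_big pi predT) //=.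
  rewrite -sum_nat_const; apply: eq_bigr => n _.
  rewrite (reindex_inj (mulIg (tau n))) -sum1_card /=; apply: eq_bigl => x.
  by rewrite piM tauK -(inj_eq (mulgI n^-1%g)) mulKg mulVg -(to1 (tau n))
       (inj_eq (act_inj _ _)) pi_eq1.
by rewrite mulnC eqn_pmul2r ?cardG_gt0 // => /eqP.
Qed.

Lemma cocycle_hopf_galois : hopf_galois L.
Proof.
have alpha2_act (p : N * N) x t :
    tens_ev (alpha (to p.1 x)) (alpha (to p.2 x)) t
    = x (tens_ev (alpha p.1) (alpha p.2) t).
  move: t; apply: (tens_ext (W := E)) => [||g h]; try exact: linearP.
    by move=> a s t; rewrite !linearP.
  by rewrite !tens_evE !alpha_act -rmorphM.
have [|h|h|Delta [eps [S [hopfH cocomH DeltaE epsE]]]] :=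
    form_of_group_algebra_hopf alpha_free alpha1 alphaM.
- move=> h.
  (* The function of coefficients supported on the diagonal is equivariant on $N \times N$, so for
     dimension reasons some tensor realises it. *)
  have dim2 : dim (tensor H H) = #|{: N * N}| by rewrite card_prod -dimH.
  have [|t tE] := equivariant_onto galE (to := TotalAction to2_1 to2_M)
    (tens_ev_injl alpha_free alpha_inj) alpha2_act dim2
    (f := fun p => (p.1 == p.2)%:R * alpha p.1 h); last first.
    by exists t => n m; rewrite (tE (n, m)).
  move=> [n m] x; rewrite /= (inj_eq (act_inj _ _)) alpha_act.
  by rewrite rmorphM rmorph_nat.
- apply: fixed_mem1 => // x.
  rewrite rmorph_sum [RHS](reindex_inj (act_inj to x)).
  by apply: eq_bigr => n _; rewrite alpha_act.
- have [|h' h'E] := equivariant_onto galE alpha_inj alpha_act dimH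
      (f := fun n => alpha n^-1%g h); last by exists h'.
  by move=> n x; rewrite -toV alpha_act.
pose act : 'Hom(H, 'End(L)) := linfun opval.
have actE h : act h = opval h := linfun_linearE opval_linear h.
exists (HopfAlgebra hopfH), act; split=> //.
- split=> [|h s t|h].
  + by split=> [|g h]; rewrite !actE.
  + apply: vsval_inj; rewrite actE /= opE.
    (* Only the diagonal terms of the double sum survive, so the equality restates the
       multiplicativity of each [tau n]. *)
    transitivity (\sum_n \sum_m tens_ev (alpha n) (alpha m) (Delta h)
        * (tau n (vsval s) * tau m (vsval t))).
      apply: eq_bigr => n _; rewrite (bigD1 n) //= big1 ?addr0.
        by rewrite DeltaE eqxx mul1r rmorphM.
      by move=> m /negPf mn; rewrite DeltaE eq_sym mn !mul0r.
    move: (Delta h); apply: (tens_ext (W := E)) => [a x y|a x y|g l].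
    * rewrite scaler_sumr -big_split; apply: eq_bigr => n _ /=.
      rewrite scaler_sumr -big_split; apply: eq_bigr => m _ /=.
      by rewrite linearP mulrDl scalerAl.
    * by rewrite !linearP.
    rewrite tens_liftE => [|v a x y|u a x y].
    * rewrite !actE /= !opE mulr_suml; apply: eq_bigr => n _.
      rewrite mulr_sumr; apply: eq_bigr => m _.
      by rewrite tens_evE mulrACA.
    * by rewrite !linearP /= !lfun_simp mulrDl scalerAl.
    * by rewrite !linearP /= !lfun_simp mulrDr scalerAr.
  have val1 : vsval (1 : L) = 1 by apply: rmorph1.
  have valA (b : k) : vsval (b%:A : L) = b%:A by rewrite -[in RHS]val1.
  apply: vsval_inj; rewrite actE opE val1 valA epsE.
  by apply: eq_bigr => n _; rewrite rmorph1 mulr1.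
pose iota : 'Hom(L, E) := linfun vsval.
have iotaE a : iota a = vsval a by rewrite lfunE.
have jE x a : vsval (hopf_galois_map (H := HopfAlgebra hopfH) act x a)
    = \sum_n tens_ev iota (alpha n) x * tau n (vsval a).
  move: x; apply: (tens_ext (W := E)) => [b x y|b x y|s h].
  - by rewrite !linearP /= !lfun_simp.
  - rewrite scaler_sumr -big_split; apply: eq_bigr => n _ /=.
    by rewrite linearP mulrDl scalerAl.
  rewrite tens_liftE => [|v e x y|u e x y].
  - rewrite comp_lfunE lfunE /= actE opE mulr_sumr.
    by apply: eq_bigr => n _; rewrite tens_evE iotaE mulrA.
  - by rewrite linearP comp_lfunDl comp_lfunZl.
  - by rewrite linearP comp_lfunDr comp_lfunZr.
(* For [x] in the kernel, [tau_free] annuls every [tens_ev iota (alpha n) x], and these evaluations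
   are jointly injective. *)
have kerj : lker (hopf_galois_map (H := HopfAlgebra hopfH) act) == 0%VS.
  rewrite -subv0; apply/subvP => x; rewrite memv_ker memv0 => /eqP jx0.
  have iota_inj : jointly_injective (fun _ : unit => iota).
    by move=> a /(_ tt); rewrite iotaE => a0; apply: vsval_inj.
  apply/eqP/(tens_ev_injr iota_inj alpha_free) => -[[] n] /=.
  move: n; apply: tau_free => a.
  by rewrite -jE jx0 zero_lfunE.
(* Source and target both have dimension $[F:k]^2$. *)
have imj : limg (hopf_galois_map (H := HopfAlgebra hopfH) act) = fullv.
  apply/eqP; rewrite eqEdim subvf limg_dim_eq ?(eqP kerj) ?capv0 // !dimvf.
  rewrite -[dim 'End(L)]/(dim L * dim L)%N.
  by rewrite -[dim (tensor _ _)]/(dim L * dim H)%N dimH dimF leqnn.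
exists (hopf_galois_map (H := HopfAlgebra hopfH) act)^-1%VF.
  exact: lker0_lfunK.
by move=> f; rewrite limg_lfunVK // imj memvf.
Qed.

End HopfGaloisFromCocycle.

(* The cocycle sends [s * v], with [s] in [S] and [v] in [V], to the pair of  *)
(* [v] and the class of [s * v] modulo [M].                                   *)
Section CocycleOfComplement.

Variables (gT : finGroupType) (V S M : {group gT}).
Hypotheses (nV : V <| [set: gT]) (nM : M <| [set: gT]).
Hypotheses (tiSV : (S :&: V = 1)%g) (defG : (S * V = [set: gT])%g).
Hypothesis defGM : (S * M = [set: gT])%g.

Let N : finGroupType := (subg_of V * coset_of M)%type.

Let memN (H : {group gT}) x : H <| [set: gT] -> x \in 'N(H)%g.
Proof. by move/normal_norm/subsetP/(_ x (in_setT x)). Qed.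

Let to (n : N) (x : gT) : N := (subg V (sgval n.1 ^ x)%g, (n.2 ^ coset M x)%g).

Let memVJ v x : (v ^ x \in V)%g = (v \in V).
Proof. by rewrite memJ_norm ?memN. Qed.

Let to_1 : to^~ 1%g =1 id.
Proof.
by case=> v c; rewrite /to /= morph1 !conjg1 sgvalK.
Qed.

Let cosetM x y : coset M (x * y)%g = (coset M x * coset M y)%g.
Proof. by apply: (morphM (coset_morphism M)); apply: memN. Qed.

Let to_M n : act_morph to n.
Proof.
by move=> x y; rewrite /to /= cosetM !conjgM subgK ?memVJ ?subgP.
Qed.

Let toA := TotalAction to_1 to_M.

Let pi (x : gT) : N := (subg V (remgr S V x), coset M x).

Let remE s v : s \in S -> v \in V -> remgr S V (s * v)%g = v.
Proof. by move=> Ss Vv; apply: remgrMid. Qed.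

Let factor x : exists2 s, s \in S & exists2 v, v \in V & x = (s * v)%g.
Proof.
have : x \in (S * V)%g by rewrite defG inE.
by case/mulsgP=> s v Ss Vv ->; exists s => //; exists v.
Qed.

Lemma complement_cocycle :
  exists (N : finGroupType) (to : {action gT &-> N}) (pi : gT -> N),
    [/\ forall m n x, to (m * n)%g x = (to m x * to n x)%g,
        forall x y, pi (x * y)%g = (pi y * to (pi x) y)%g,
        forall n, exists x, pi x = n
      & forall x, (pi x == 1%g) = (x \in S :&: M)].
Proof.
have sgval_inj := can_inj (@sgvalK _ V).
exists N, toA, pi; split.
- move=> [v c] [w d] x; rewrite /= /to /= conjMg.
  congr (_, _); last by rewrite /= conjMg.
  apply: sgval_inj.
  have [Vv Vw] := (subgP v, subgP w).
  have [Vvx Vwx] : (sgval v ^ x \in V)%g /\ (sgval w ^ x \in V)%g.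
    by rewrite !memVJ.
  by rewrite /= !subgK // groupM.
- move=> x y; have [s Ss [v Vv ->]] := factor x.
  have [t St [w Vw ->]] := factor y.
  have Vvt : (v ^ t)%g \in V by rewrite memVJ.
  (* Normal form of the product: $s v t w = (s t)(v^t w)$, with $v^t w$ in $V$. *)
  have -> : (pi (s * v * (t * w))
      = (subg V (v ^ t * w), coset M (s * v * (t * w))))%g.
    rewrite /pi (_ : (s * v * (t * w) = s * t * (v ^ t * w))%g).
      by rewrite remE // groupM.
    by rewrite conjgE !mulgA mulgK.
  rewrite /pi !remE // /= /to /=; apply: injective_projections; last first.
    by rewrite [LHS]cosetM [RHS]/= conjgE mulKVg.
  have Vvx : (v ^ (t * w))%g \in V by rewrite memVJ.
  have [V1 V2] := (groupM Vvt Vw, groupM Vw Vvx).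
  apply: sgval_inj; rewrite /= !subgK //.
  by rewrite conjgM [in RHS]conjgE mulKVg.
- case=> v c; have [g _ ->] := cosetP c.
  (* Factoring $g v^{-1}$ in $S M$ yields an $s$ in $S$ with $s v \in g M$. *)
  have : (g * (sgval v)^-1)%g \in (S * M)%g by rewrite defGM inE.
  case/mulsgP=> s m Ss Mm gv; exists (s * sgval v)%g.
  rewrite /pi remE ?subgP // sgvalK; congr (_, _).
  have -> : (s = g * (sgval v)^-1 * m^-1)%g by rewrite gv mulgK.
  rewrite !cosetM (coset_id (groupVr Mm)) mulg1 -mulgA -cosetM mulVg.
  by rewrite morph1 mulg1.
move=> x; rewrite inE; have [s Ss [v Vv ->]] := factor x.
rewrite xpair_eqE remE //; congr (_ && _).
  rewrite -(inj_eq sgval_inj) /= subgK // groupMl //.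
  apply/eqP/idP => [->|Sv]; first exact: group1.
  by apply/set1gP; rewrite -tiSV inE Sv.
by apply/eqP/idP => [/coset_idr->|/coset_id->] //; apply: memN.
Qed.

End CocycleOfComplement.

Lemma complement_hopf_galois (k : fieldType) (E : splittingFieldType k)
    (F : {subfield E}) (V S M : {group gal_of {:E}}) :
    galois 1%VS {:E} -> V <| [set: gal_of {:E}] -> M <| [set: gal_of {:E}] ->
    (S :&: V = 1)%g -> (S * V = setT)%g -> (S * M = setT)%g ->
    'Gal({:E} / F)%g = S :&: M ->
  hopf_galois (subvs_of F).
Proof.
move=> galE nV nM tiSV defG defGM galF.
have [N [to [pi [toM piM pi_onto pi_eq1]]]] :=
  complement_cocycle nV nM tiSV defG defGM.
by apply: (cocycle_hopf_galois galE toM piM pi_onto) => x; rewrite pi_eq1 galF.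
Qed.

(** * Groups of order 24 *)

Section Translations.

Local Open Scope nat_scope.
Local Open Scope group_scope.

Variables (gT : finGroupType) (G H : {group gT}).

Lemma translationE x X : x \in G -> X \in rcosets H G ->
  translation G H x X = X :* x.
Proof. by move=> Gx GX; rewrite actpermE actbyE //= rcosetE. Qed.

Lemma translation_Sym : translation G H @* G \subset perm.Sym (rcosets H G).
Proof.
apply/subsetP => _ /morphimP[x Gx _ ->]; rewrite inE; apply/subsetP => X.
by apply: contraR => notX; rewrite /= actpermE /= /actby (negPf notX).
Qed.

Lemma translation_ker_sub : 'ker (translation G H) \subset H.
Proof.
apply/subsetP => x Kx; have Gx := dom_ker Kx.
have := mker Kx => /permP/(_ (H :* 1)); rewrite perm1 translationE //.
  by rewrite rcoset1 => <-; apply: rcoset_refl.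
by apply/rcosetsP; exists 1.
Qed.

Lemma card_translation_dvd : (#|translation G H @* G| %| #|G : H|`!)%N.
Proof.
by rewrite -(perm.card_Sym (rcosets H G)); apply: cardSg translation_Sym.
Qed.

End Translations.

Section Order24.

Local Open Scope nat_scope.
Local Open Scope group_scope.

(** Such a [Q] would be a normal Sylow 2-subgroup, hence contain every 2-element, in particular the
    transpositions, which generate. *)
Lemma S4_no_normal8 (Q : {group 'S_4}) : Q <| [set: 'S_4] -> #|Q| <> 8.
Proof.
move=> nQ oQ; have oS : #|[set: 'S_4]| = 24 by rewrite cardsT card_Sn.
have sylQ : 2.-Sylow([set: 'S_4]) Q.
  by rewrite pHallE subsetT oQ oS -[24]/(8 * 3)%N p_part.
have QT : Q :=: setT.
  apply/eqP; rewrite eqEsubset subsetT; apply/subsetP => s _.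
  have [ts -> _] := prod_tpermP s; apply: group_prod => t _.
  rewrite (mem_normal_Hall sylQ nQ) ?inE // /p_elt.
  rewrite (pnat_dvd (n := 2)) // order_dvdn expgS expg1.
  by rewrite tperm2.
by have := oQ; rewrite QT oS.
Qed.

Variables (gT : finGroupType) (G S : {group gT}).
Hypotheses (oG : #|G| = 24) (sSG : S \subset G) (oS : #|S| = 6).
Hypothesis coreS : forall P : {group gT}, P <| G -> P \subset S -> P :=: 1.
Hypothesis no_normal8 : forall Q : {group gT}, Q <| G -> #|Q| <> 8.

(* The kernel of the action on the three cosets of a Sylow 2-subgroup.        *)
Lemma normal4_exists : exists2 V : {group gT}, V <| G & #|V| = 4.
Proof.
have [Q sylQ] := Sylow_exists 2 G; have sQG := pHall_sub sylQ.
have oQ : #|Q| = 8 by rewrite (card_Hall sylQ) oG -[24]/(8 * 3)%N p_part.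
exists [group of 'ker (translation G Q)]; first exact: ker_normal.
have sKQ := translation_ker_sub G Q; set K := 'ker _ in sKQ *.
have oK : (24 %/ #|K| %| 6)%N.
  have := card_translation_dvd G Q; rewrite -divgS // oG oQ.
  by rewrite card_morphim setIid -divgS ?subsetIl // oG.
have: (#|K| %| 8)%N by rewrite -oQ cardSg.
have nK : K <| G by apply: ker_normal.
(* The order of [K] divides 8 and is a multiple of 4, as its index divides 6. *)
rewrite dvdn_divisors //= !inE; case/or4P => /eqP K_n //; rewrite K_n // in oK.
by have := no_normal8 nK.
Qed.

(* [A = V P] with [P] the Sylow 3-subgroup of [S]: then ['N_G(P) = S], and    *)
(* [#|A :&: S| = 3] because [#|A : A :&: S|] is 1 modulo 3.                   *)
Lemma order24_subgroups :
  exists V A : {group gT}, [/\ V <| G, #|V| = 4 & V :&: S = 1]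
    /\ [/\ A <| G, #|A| = 12 & #|A :&: S| = 3].
Proof.
have [V nV oV] := normal4_exists; have [P sylP] := Sylow_exists 3 S.
have sPS := pHall_sub sylP; have sPG := subset_trans sPS sSG.
have oP : #|P| = 3 by rewrite (card_Hall sylP) oS -[6]/(2 * 3)%N p_part.
have nPS : P <| S by apply: index2_normal => //; rewrite -divgS // oS oP.
have sylPG : 3.-Sylow(G) P.
  by rewrite pHallE sPG oP oG -[24]/(8 * 3)%N p_part.
have defS : 'N_G(P) = S.
  have sSN : S \subset 'N_G(P) by rewrite subsetI sSG normal_norm.
  have /dvdnP[n oN] := cardSg sSN; rewrite oS in oN.
  (* The index of the normaliser divides 4 and is 1 modulo 3. Index 1 would make [P] a nontrivial
     normal subgroup of [G] inside [S], so it is 4 and [n = 1]. *)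
  have e4 : (n * #|G : 'N_G(P)|)%N = 4.
    apply/eqP; rewrite -(eqn_pmul2r (m := 6)) // mulnAC -oN.
    by rewrite Lagrange ?subsetIl ?oG.
  have: #|G : 'N_G(P)| %| 4 by rewrite -e4 dvdn_mull.
  have := card_Syl_mod G (isT : prime 3); rewrite (card_Syl sylPG).
  rewrite dvdn_divisors //= => mod3; rewrite !inE => /or3P[] /eqP i_n.
  - have /coreS/(_ sPS) P1 : P <| G.
      rewrite /normal sPG; have /eqP := i_n; rewrite indexg_eq1.
      by rewrite subsetI subxx.
    by rewrite P1 cards1 in oP.
  - by rewrite i_n in mod3.
  apply/esym/eqP; rewrite eqEcard sSN oS oN.
  by move: e4; rewrite i_n; case: n {oN} => [|[]].
have tiVP : V :&: P = 1 by rewrite coprime_TIg // oV oP.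
have nVP : P \subset 'N(V) by rewrite (subset_trans sPG) // normal_norm.
have oA : #|V <*> P| = 12 by rewrite norm_joinEr // TI_cardMg // oV oP.
have sAG : V <*> P \subset G by rewrite join_subG normal_sub.
have nA : V <*> P <| G by apply: index2_normal => //; rewrite -divgS // oG oA.
have sylPA : 3.-Sylow(V <*> P) P.
  by rewrite pHallE joing_subr oP oA -[12]/(4 * 3)%N p_part.
have oAS : #|(V <*> P) :&: S| = 3.
  have defN : 'N_(V <*> P)(P) = (V <*> P) :&: S.
    by rewrite -defS setIA (setIidPl sAG).
  have := card_Syl_mod (V <*> P) (isT : prime 3).
  rewrite (card_Syl sylPA) /= defN.
  have /dvdnP[m om] : 3 %| #|(V <*> P) :&: S|.
    by rewrite -oP cardSg // subsetI joing_subr.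
  have : #|(V <*> P) :&: S| %| 6 by rewrite -oS cardSg ?subsetIr.
  rewrite -divgS ?subsetIl //= oA om -[6]/(2 * 3)%N dvdn_pmul2r //.
  by case: m {om} => [|[|[|m]]] // /dvdn_leq.
exists V, (V <*> P)%G; split; split=> //.
(* As [V] lies in $A$, its intersection with [S] lies in $A \cap S$, whose order 3 is prime to 4. *)
apply/eqP; rewrite -subG1 -(coprime_TIg (G := V) (H := (V <*> P) :&: S)%G).
  by rewrite setIA setSI // subsetI subxx joing_subl.
by rewrite oV oAS.
Qed.

End Order24.

(** * Regular subgroups from normal complements *)

Section RegularSubgroups.

Local Open Scope group_scope.

(** Sharp transitivity makes evaluation at [x] a bijection from [N] onto [X]. *)
Lemma card_regular (rT : finType) (X : {set rT}) (N : {group {perm rT}}) x :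
  regular_on X N -> x \in X -> #|N| = #|X|.
Proof.
move=> [sNX regN] Xx; rewrite -(card_in_imset (f := fun s : {perm rT} => s x)).
  apply: eq_card => y; apply/imsetP/idP => [[s Ns ->] | Xy].
    have /(subsetP sNX) := Ns; rewrite inE => /perm_closed->.
    exact: Xx.
  by have [s [[Ns sx] _]] := regN x y Xx Xy; exists s.
move=> s t Ns Nt st; have /(subsetP sNX) := Ns; rewrite inE => sX.
have Xsx : s x \in X by rewrite perm_closed.
have [u [_ uE]] := regN x (s x) Xx Xsx.
by rewrite -(uE s) ?(uE t).
Qed.

Variables (gT : finGroupType) (G H A : {group gT}).

(** Writing $g' g^{-1} = h b$ with $h$ in $H$ and $b$ in $A$, the element $b^g$ of $A$ takes $H g$
    to $H g'$. Two such elements differ by a conjugate of an element of $H \cap A$. *)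
Lemma complement_regular :
    A <| G -> H :&: A = 1 -> H * A = G ->
  regular_on (rcosets H G) (translation G H @* A).
Proof.
move=> nA tiHA defG; have sAG := normal_sub nA; split.
  exact: subset_trans (morphimS _ sAG) (translation_Sym G H).
move=> _ _ /rcosetsP[g Gg ->] /rcosetsP[g' Gg' ->].
have GX x : x \in G -> H :* x \in rcosets H G.
  by move=> Gx; apply/rcosetsP; exists x.
have : (g' * g^-1) \in H * A by rewrite defG groupM ?groupV.
case/mulsgP=> h b Hh Ab e.
have Aa : b ^ g \in A by rewrite memJ_norm // (subsetP (normal_norm nA)).
have Ga := subsetP sAG _ Aa.
have aE : (translation G H) (b ^ g) (H :* g) = H :* g'.
  rewrite translationE ?GX // -rcosetM -conjgC -[g'](mulgKV g) e.
  by rewrite -mulgA [RHS]rcosetM (rcoset_id Hh).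
exists (translation G H (b ^ g)); split.
  by split=> //; apply: mem_morphim.
move=> _ [/morphimP[c Gc Ac ->] cE]; congr (translation G H _).
move: cE; rewrite -aE !translationE ?GX // -!rcosetM => cE.
have Hd : ((b ^ g) * c^-1) ^ g^-1 \in H.
  have : g * (b ^ g) * (g * c)^-1 \in H by rewrite -mem_rcoset cE rcoset_refl.
  by rewrite [_ ^ g^-1]conjgE invgK invMg !mulgA.
have: ((b ^ g) * c^-1) ^ g^-1 \in H :&: A.
  have Ad := groupM Aa (groupVr Ac).
  by rewrite inE Hd memJ_norm // (subsetP (normal_norm nA)) ?groupV.
rewrite tiHA => /set1P/eqP; rewrite conjg_eq1 => /eqP/(canRL (mulgK _)).
by rewrite invgK mul1g.
Qed.

End RegularSubgroups.

(** * Intermediate fields of the Galois closure of a quartic extension with group $S_4$ *)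

Theorem proposition2p1 (k : fieldType) (E : splittingFieldType k)
    (K F : {subfield E})
    (sepK : separable 1%VS K) (degK : \dim K = 4%N)
    (closK : galois_closure K {:E}%AS)
    (galS4 : ('Gal({:E} / 1%VS) \isog [set: 'S_4])%g)
    (sKF : (K <= F)%VS) :
  [/\ hopf_galois (subvs_of F),
      \dim F = 12%N -> almost_classically_galois F
    & \dim F = 8%N -> ~ almost_classically_galois F].
Proof.
have [_ galE minE] := closK.
pose G := 'Gal({:E} / 1%VS)%G; pose S := 'Gal({:E} / K)%G.
pose H := 'Gal({:E} / F)%G.
have GT : G :=: setT by apply/setP => x; rewrite inE mem_gal1.
have sHS : H \subset S by apply: galS.
have sSG : S \subset G by rewrite GT subsetT.
have sHG : H \subset G by rewrite GT subsetT.
have oG : #|G| = 24%N by rewrite (card_isog galS4) cardsT card_Sn.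
have dimE : \dim {:E} = 24%N by rewrite -oG -(galois_dim galE) dimv1 divn1.
have galL (L : {subfield E}) : galois L {:E}.
  by rewrite (galoisS _ galE) ?sub1v ?subvf.
have oGal (L : {subfield E}) : (#|'Gal({:E} / L)%g| * \dim L = 24)%N.
  by rewrite -(galois_dim (galL L)) divnK ?dimE // -dimE field_dimS ?subvf.
have oS : #|S| = 6%N.
  by apply/eqP; rewrite -(eqn_pmul2r (m := 4%N)) // -{1}degK oGal.
(* The fixed field of a normal [P] inside [S] is Galois over $k$ and contains $K$, hence is all of
   $E$ by minimality of the closure. *)
have coreS (P : {group gal_of {:E}}) : P <| G -> P \subset S -> P :=: 1%g.
  move=> nP sPS; apply/trivgP; rewrite -(gal_fixedField P).
  have sKP : (K <= fixedField P)%VS by rewrite -galois_connection ?subvf.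
  have sEP := minE _ sKP (normal_fixedField_galois galE nP).
  apply: subset_trans (galS _ sEP) _.
  by rewrite -(gal_fixedField 1%G) galS // fixedField_bound.
have no8 (Q : {group gal_of {:E}}) : Q <| G -> #|Q| <> 8%N.
  have [f injf fG] := isogP galS4; move=> nQ oQ.
  apply: (S4_no_normal8 (Q := (f @* Q)%G)); first by rewrite -fG morphim_normal.
  by rewrite card_injm // normal_sub.
have [V [A [[nV oV tiVS] [nA oA oAS]]]] :=
  order24_subgroups oG sSG oS coreS no8.
have oH : (#|H| * \dim F = 24)%N by apply: oGal.
(* $A \cap S$ is a normal Sylow 3-subgroup of [S], hence contains every subgroup of [S] of order
   3. *)
have defHA : #|H| = 3%N -> S :&: A = H.
  move=> oH3; rewrite setIC; have nAS : A :&: S <| S.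
    by rewrite setIC (normalGI sSG).
  have sylAS : 3.-Sylow(S) (A :&: S).
    by rewrite pHallE subsetIr oAS oS -[6%N]/(2 * 3)%N p_part.
  apply/esym/eqP; rewrite eqEcard oAS oH3 leqnn andbT.
  by rewrite (sub_normal_Hall sylAS) // /pgroup oH3.
have tiHA : #|H| = 2%N -> H :&: A = 1%g.
  move=> oH2; apply: card1_trivg; apply/eqP.
  have d2 : (#|H :&: A| %| 2)%N by rewrite -oH2 cardSg ?subsetIl.
  have sHAS : H :&: A \subset A :&: S by rewrite setIC setIS.
  have d3 : (#|H :&: A| %| 3)%N by rewrite -oAS; apply: cardSg sHAS.
  by rewrite -dvdn1 -[1%N]/(gcdn 2 3) dvdn_gcd d2.
have mulGT (X Y : {group gal_of {:E}}) : (#|X| * #|Y| = 24 * #|X :&: Y|)%N ->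
    (X * Y = [set: gal_of {:E}])%g.
  move=> oXY; apply/eqP; rewrite eqEcard subsetT -GT oG /=.
  by rewrite -(leq_pmul2r (cardG_gt0 (X :&: Y))) -mul_cardG oXY.
split.
- have: (#|H| %| 6)%N by rewrite -oS cardSg.
  have AG : A <| [set: gal_of {:E}] by rewrite -GT.
  have VG : V <| [set: gal_of {:E}] by rewrite -GT.
  have TG : [set: gal_of {:E}]%G <| [set: gal_of {:E}] by [].
  have tiSV : S :&: V = 1%g by rewrite setIC.
  (* For [H] of order 1, 2, 3, 6 the triple of normal subgroup, complement and [M] is $(G, H, G)$,
     $(A, H, G)$, $(V, S, A)$, $(V, S, G)$. *)
  rewrite dvdn_divisors //= !inE => /or4P[] /eqP oHn.
  + have H1 : H :=: 1%g by apply: card1_trivg.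
    apply: (complement_hopf_galois galE TG TG (S := H)).
    * by rewrite H1; apply/trivgP/subsetIl.
    * by rewrite H1 mul1g.
    * by rewrite H1 mul1g.
    * by rewrite setIT.
  + apply: (complement_hopf_galois galE AG TG (S := H)) (tiHA oHn) _ _ _.
    * by apply: mulGT; rewrite tiHA // cards1 oHn oA.
    * by apply: mulGT; rewrite /= setIT -GT oG mulnC.
    * by rewrite setIT.
  + apply: (complement_hopf_galois galE VG AG tiSV).
    * by apply: mulGT; rewrite tiSV cards1 oS oV.
    * by apply: mulGT; rewrite setIC oAS oS oA.
    * by rewrite defHA.
  + have HS : H :=: S by apply/eqP; rewrite eqEcard sHS oHn oS.
    apply: (complement_hopf_galois galE VG TG tiSV).
    * by apply: mulGT; rewrite tiSV cards1 oS oV.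
    * by apply: mulGT; rewrite /= setIT -GT oG mulnC.
    * by rewrite setIT -HS.
- move=> oF.
  have oH2 : #|H| = 2%N.
    move: oH; rewrite oF -[24%N]/(2 * 12)%N => /eqP.
    by rewrite eqn_pmul2r // => /eqP.
  exists {:E}%AS.
    by split=> [||L sFL]; rewrite ?subvf //; apply: minE; apply: subv_trans sFL.
  exists (translation G H @* A)%G; split.
  + apply: complement_regular => //; first exact: tiHA.
    by rewrite GT; apply: mulGT; rewrite tiHA // cards1 oH2 oA.
  + by rewrite morphim_norms // normal_norm.
  + by rewrite morphimS // normal_sub.
move=> oF [M [sFM galM minM] [N [regN normN sN]]].
(* A Galois extension of $k$ containing $F$ contains $K$, so the closure of $F$ is also $E$. *)
have defM : M = {:E}%AS.
  apply: val_inj; apply/eqP; rewrite eqEsubv subvf.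
  by apply: minE => //; apply: subv_trans sFM.
subst M.
have oH3 : #|H| = 3%N.
  move: oH; rewrite oF -[24%N]/(3 * 8)%N => /eqP.
  by rewrite eqn_pmul2r // => /eqP.
have injT : 'injm (translation G H).
  have sKH := translation_ker_sub G H.
  rewrite (coreS ('ker (translation G H))%G) ?ker_normal //.
  exact: subset_trans sKH sHS.
have oN : #|N| = 8%N.
  have H1 : H :* 1%g \in rcosets H G by apply/rcosetsP; exists 1%g.
  by rewrite (card_regular regN H1) -[LHS]/(#|G : H|) -divgS // oG oH3.
(* The translation action is injective and [N] lies in its image, so the preimage of [N] is a normal
   subgroup of order 8. *)
apply: (no8 (translation G H @*^-1 N)%G).
  rewrite /normal subsetIl; have := morphpre_norms (translation G H) normN.
  by rewrite morphimGK ?subsetIl.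
by rewrite -(card_injm injT) ?subsetIl // morphpreK.
Qed.
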